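(* Let $\mathbb F$ be a field of characteristic $0$. Let $H, H'$ be $\mathbb F$-weighted graphs (both directed or both undirected) such that $H$ is twin-free and $m = |V(H)| \ge m' = |V(H')|$. Let $k \ge 0$ and let $\varphi \colon [k] \to V(H)$ and $\psi \colon [k] \to V(H')$. If $\hom_\varphi(G, H) = \hom_\psi(G, H')$ for every $G \in \mathcal{PLG}^{\mathrm{simp}}[k]$, then there exists an isomorphism of $\mathbb F$-weighted graphs $\sigma \colon V(H) \to V(H')$ from $H$ to $H'$ such that $\psi = \sigma \circ \varphi$ (in particular, $H'$ is twin-free and $m = m'$).
   Context: $[k]=\{1,\dots,k\}$, $[0]=\emptyset$, and $0^0=1$. An $\mathbb F$-weighted graph $H$ (directed or undirected) consists of a finite (possibly empty) vertex set $V(H)$, a vertex weight $\alpha_H(i) \in \mathbb F\setminus\{0\}$ for each vertex $i$, and an edge weight $\beta_H(i,j)\in\mathbb F$ for every ordered pair $(i,j)\in V(H)^2$ (including $i=j$); in the undirected case $\beta_H(i,j)=\beta_H(j,i)$. An isomorphism of $\mathbb F$-weighted graphs from $H$ to $H'$ is a bijection $\sigma\colon V(H)\to V(H')$ with $\alpha_{H'}(\sigma(i))=\alpha_H(i)$ and $\beta_{H'}(\sigma(i),\sigma(j))=\beta_H(i,j)$ for all $i,j$. Two vertices $i,j$ of $H$ are twins if $\beta_H(i,\ell)=\beta_H(j,\ell)$ and $\beta_H(\ell,i)=\beta_H(\ell,j)$ for all $\ell\in V(H)$; $H$ is twin-free if no two distinct vertices are twins. A $k$-labeled graph $G$ is a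 finite graph (directed if $H,H'$ are directed, undirected otherwise) without loops but possibly with multiple edges, in which $k$ distinct nodes $u_1,\dots,u_k$ carry the labels $1,\dots,k$ (other nodes are unlabeled). $\mathcal{PLG}^{\mathrm{simp}}[k]$ denotes the set of (isomorphism classes of) simple $k$-labeled graphs: no loops, at most one edge between any two vertices (in the directed case, not both $u\to v$ and $v\to u$), and no edge between two labeled vertices. For $\psi\colon[k]\to V(H)$, $\hom_\psi(G,H)=\sum_{\phi}\prod_{u\in V(G)\setminus\{u_1,\dots,u_k\}}\alpha_H(\phi(u))\prod_{uv\in E(G)}\beta_H(\phi(u),\phi(v))$, where the sum is over all maps $\phi\colon V(G)\to V(H)$ with $\phi(u_i)=\psi(i)$ for all $i\in[k]$, the edge product is over edges with multiplicity, and a directed edge $u\to v$ contributes $\beta_H(\phi(u),\phi(v))$. *)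

(* Defs.v *)
From HB Require Import structures.
From mathcomp Require Import all_boot all_order all_algebra.

Set Implicit Arguments.
Unset Strict Implicit.
Unset Printing Implicit Defensive.

Import GRing.Theory.
Local Open Scope ring_scope.

(* Throughout, [dir = true] is the directed case and [dir = false] the
   undirected one. *)

Record wgraph (F : fieldType) (dir : bool) := WGraph {
  vertex : finType;
  vweight : vertex -> F;
  eweight : vertex -> vertex -> F;
  vweight_neq0 : forall i, vweight i != 0;
  eweight_sym : ~~ dir -> forall i j, eweight i j = eweight j i
}.

Definition wgraph_iso (F : fieldType) (dir : bool) (H H' : wgraph F dir)
    (sigma : vertex H -> vertex H') : Prop :=
  [/\ bijective sigma,
      forall i, vweight (sigma i) = vweight i
    & forall i j, eweight (sigma i) (sigma j) = eweight i j].

Definition twins (F : fieldType) (dir : bool) (H : wgraph F dir)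
    (i j : vertex H) : Prop :=
  forall l, eweight i l = eweight j l /\ eweight l i = eweight l j.

Definition twin_free (F : fieldType) (dir : bool) (H : wgraph F dir) : Prop :=
  forall i j : vertex H, i <> j -> ~ twins i j.

(* Loopless multigraphs: [mult u v] is the number of edges u -> v if [dir],
   and the number of edges joining u and v otherwise. *)
Record lgraph (dir : bool) (k : nat) := LGraph {
  node : finType;
  mult : node -> node -> nat;
  label : 'I_k -> node;
  mult_loop : forall u, mult u u = 0%N;
  mult_sym : ~~ dir -> forall u v, mult u v = mult v u;
  label_inj : injective label
}.

Definition nedges_between (dir : bool) (k : nat) (G : lgraph dir k)
    (u v : node G) : nat :=
  if dir then (mult u v + mult v u)%N else mult u v.

Definition PLG_simp (dir : bool) (k : nat) (G : lgraph dir k) : Prop :=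
  (forall u v : node G, (nedges_between u v <= 1)%N) /\
  (forall i j : 'I_k, nedges_between (label G i) (label G j) = 0%N).

(* In the undirected case each unordered pair {u, v} must contribute once: the
   enumeration of the nodes selects one of its two orderings, and which one is
   immaterial since [eweight] and [mult] are then symmetric. *)
Definition edge_pair (dir : bool) (k : nat) (G : lgraph dir k)
    (u v : node G) : bool :=
  dir || (enum_rank u < enum_rank v)%N.

Definition hom_lab (F : fieldType) (dir : bool) (k : nat) (G : lgraph dir k)
    (H : wgraph F dir) (psi : 'I_k -> vertex H) : F :=
  \sum_(phi : {ffun node G -> vertex H} | [forall i, phi (label G i) == psi i])
    (\prod_(u | u \notin codom (label G)) vweight (phi u)) *
    (\prod_(u : node G) \prod_(v : node G | edge_pair u v)
       eweight (phi u) (phi v) ^+ mult u v).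

(* Main.v *)
(* For gadgets G whose labels are pairwise non-adjacent, G |-> hom_phi(G, H) is
   multiplicative under gluing along the labels, and removing labels sums over
   all extensions of phi. Extend phi to eta by giving every vertex of H many
   additional labels. Independence of characters shows that the vertex weights,
   summed over the extensions of phi with the same character as eta, agree with
   the corresponding sum over the extensions of psi. With so many labels, the
   graphs with one or two unlabeled nodes already determine H up to an
   isomorphism compatible with the labeling, because the vertices of a twin-free
   graph are separated by bounded-degree polynomials in the edge weights to the
   labels. So the extensions in the class of eta are its images under
   automorphisms of H, and the sum on the side of H is a positive multiple of a
   product of vertex weights, hence nonzero in characteristic 0. Therefore psi
   has an extension with the character of eta, and the same rigidity yields
   sigma. *)
Require Import Defs.
From HB Require Import structures.
From mathcomp Require Import all_boot all_order all_algebra.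
From mathcomp Require Import ring.

Set Implicit Arguments.
Unset Strict Implicit.
Unset Printing Implicit Defensive.

Import GRing.Theory.
Local Open Scope ring_scope.

(** * Sums and products over functions on disjoint unions and over oriented edges *)

Definition join (A B V : Type) (a : A -> V) (b : B -> V) (x : A + B) : V :=
  match x with inl i => a i | inr j => b j end.

Lemma sum_ffun_join (R : nmodType) (A B V : finType)
    (Q : {ffun A + B -> V} -> R) :
  \sum_f Q f = \sum_(a : {ffun A -> V}) \sum_(b : {ffun B -> V})
    Q (finfun (join a b)).
Proof.
rewrite pair_big /=.
pose split (f : {ffun A + B -> V}) :=
  ([ffun x => f (inl x)], [ffun y => f (inr y)]).
rewrite (reindex (fun p : {ffun A -> V} * {ffun B -> V} =>
  finfun (join p.1 p.2))) //=.
exists split => [[a b] _ | f _].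
  by congr pair; apply/ffunP => x; rewrite !ffunE.
by apply/ffunP => -[x|x]; rewrite !ffunE /= ffunE.
Qed.

Lemma sum_ffun_unit (R : nmodType) (V : finType) (Q : {ffun unit -> V} -> R) :
  \sum_f Q f = \sum_v Q [ffun=> v].
Proof.
rewrite (reindex (fun v : V => [ffun _ : unit => v])) //=.
exists (fun f : {ffun unit -> V} => f tt) => [v _ | f _]; first by rewrite ffunE.
by apply/ffunP => -[]; rewrite ffunE.
Qed.

(** In the undirected case asymmetry makes the exponent the sum of [r u v] and [r v u]. Exchanging u
    and v in the second half, with [beta] symmetric, supplies the pairs with [rk v < rk u]; the
    diagonal contributes 1. *)
Lemma prod_oriented_edges (R : comNzRingType) (T : finType) (dir : bool)
    (r : rel T) (beta : T -> T -> R) (rk : T -> nat) :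
  (forall u v, r u v -> ~~ r v u) -> injective rk ->
  (~~ dir -> forall u v, beta u v = beta v u) ->
  \prod_u \prod_(v | dir || (rk u < rk v)%N)
    beta u v ^+ (if dir then r u v else r u v || r v u) =
  \prod_u \prod_v beta u v ^+ r u v.
Proof.
move=> r_asym rk_inj; case: dir => //= /(_ isT) beta_sym.
have r_irr u : r u u = false by apply/negP => ruu; have := r_asym u u ruu; rewrite ruu.
transitivity (\prod_u \prod_(v | (rk u < rk v)%N) beta u v ^+ r u v *
              \prod_u \prod_(v | (rk u < rk v)%N) beta u v ^+ r v u).
  rewrite -big_split; apply: eq_bigr => u _; rewrite -big_split.
  apply: eq_bigr => v _ /=; rewrite -exprD; congr (_ ^+ _).
  by case: (boolP (r u v)) => [/r_asym/negbTE ->|].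
rewrite [X in _ * X](exchange_big_dep xpredT) //= -big_split.
apply: eq_bigr => u _ /=.
rewrite [RHS](bigID (fun v => (rk u < rk v)%N)) /=; congr (_ * _).
rewrite [RHS](bigID (fun v => (rk v < rk u)%N)) /=.
rewrite [X in _ = _ * X]big1 ?mulr1.
  apply: eq_big => [v|v _]; last by rewrite beta_sym.
  by case: ltngtP.
move=> v /andP [h1 h2]; suff -> : v = u by rewrite r_irr.
by apply: rk_inj; move: h1 h2; case: ltngtP.
Qed.

(** * Independence of characters with a degree bound *)

Section Separation.

Variables (F : fieldType) (X K : finType) (g : K -> X -> F) (c : X -> F).

(* Linear independence of characters, with the degree of the interpolation
   polynomial recorded: products of at most [#|X|] of the [g kap] suffice. *)
Lemma separation :
  (forall ks : seq K, (size ks <= #|X|)%N ->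
     \sum_x c x * \prod_(kap <- ks) g kap x = 0) ->
  forall x0, \sum_(x | [forall kap, g kap x == g kap x0]) c x = 0.
Proof.
move=> c0 x0; pose eqv x := [forall kap, g kap x == g kap x0].
(* P is a Lagrange interpolation polynomial in the [g kap]: 0 on [ys] and 1 on the class of x0. Each
   point of [ys] costs one linear factor, so the length allowed for [ks] drops by [size ys]. *)
have interp ys : all (predC eqv) ys -> exists P : X -> F,
    [/\ forall y, y \in ys -> P y = 0, forall x, eqv x -> P x = 1
      & forall ks : seq K, (size ks + size ys <= #|X|)%N ->
          \sum_x c x * P x * \prod_(kap <- ks) g kap x = 0].
  elim: ys => [_|y ys IH /= /andP [ney /IH [P [P0 P1 Ps]]]].
    exists (fun=> 1); split=> // ks; rewrite addn0 => /c0 h.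
    by rewrite -[RHS]h; apply: eq_bigr => x _; rewrite mulr1.
  have [kap ne] := forallPn ney.
  have d0 : g kap x0 - g kap y != 0 by rewrite subr_eq0 eq_sym.
  exists (fun x => P x * ((g kap x - g kap y) / (g kap x0 - g kap y))).
  split=> [z | x xx0 | ks le].
  - rewrite inE => /orP [/eqP -> | /P0 ->]; last by rewrite mul0r.
    by rewrite subrr mul0r mulr0.
  - by rewrite P1 // (eqP (forallP xx0 kap)) divff ?mulr1.
  have h1 : (size (kap :: ks) + size ys <= #|X|)%N by rewrite /= addSn -addnS.
  have h2 : (size ks + size ys <= #|X|)%N by rewrite ltnW // -addnS.
  transitivity ((\sum_x c x * P x * \prod_(k <- kap :: ks) g k x
       - g kap y * \sum_x c x * P x * \prod_(k <- ks) g k x)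
       / (g kap x0 - g kap y)).
    rewrite mulr_sumr -sumrB mulr_suml; apply: eq_bigr => x _.
    rewrite big_cons; set q := \prod_(_ <- _) _; set e := _^-1.
    by ring.
  by rewrite Ps // Ps // mulr0 subrr mul0r.
have [|P [P0 P1 Ps]] := interp (enum (predC eqv)).
  by apply/allP => x; rewrite mem_enum.
have := Ps [::]; rewrite /= add0n -cardE max_card => /(_ isT) h.
rewrite -[RHS]h [RHS](bigID eqv) /= [Z in _ = _ + Z]big1 ?addr0.
  by apply: eq_bigr => x xx0; rewrite P1 // big_nil !mulr1.
by move=> x nx; rewrite P0 ?mulr0 ?mul0r // mem_enum.
Qed.

End Separation.

(** * Gadgets and their values *)

(* A simple graph whose labels are the elements of [A] and whose unlabeled
   nodes are those of [inner]; [att w a] is [Some true] for an edge w -> a,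
   [Some false] for an edge a -> w, and [None] if w and a are not adjacent.
   In the undirected case the orientation is an arbitrary choice. *)
Record gadget (A : Type) := Gadget {
  inner : finType;
  att : inner -> A -> option bool;
  adj : rel inner;
  adj_asym : forall u v, adj u v -> ~~ adj v u
}.

Section Gadgets.

Variables (F : fieldType) (dir : bool).
Implicit Types H : wgraph F dir.

Definition link H (o : option bool) (v a : vertex H) : F :=
  match o with
  | None => 1
  | Some true => eweight v a
  | Some false => eweight a v
  end.

(** The formula does not depend on [dir]: [adj] is asymmetric, so each inner edge enters through
    exactly one ordered pair. *)
Definition gval (A : finType) (G : gadget A) H (eta : A -> vertex H) : F :=
  \sum_(f : {ffun inner G -> vertex H}) \prod_w
     (vweight (f w) * (\prod_a link (att w a) (f w) (eta a)) *
      \prod_w' eweight (f w) (f w') ^+ adj w w').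

(** * Gadgets as simple labeled graphs *)

Section Realization.

Variables (k : nat) (G : gadget 'I_k).

Definition orientation (x y : 'I_k + inner G) : bool :=
  match x, y with
  | inl _, inl _ => false
  | inr w, inl i => att w i == Some true
  | inl i, inr w => att w i == Some false
  | inr w, inr w' => adj w w'
  end.

Lemma orientation_asym x y : orientation x y -> ~~ orientation y x.
Proof.
by case: x y => [i|w] [j|w'] //=; [move/eqP-> | move/eqP-> | move/adj_asym].
Qed.

Definition gadget_mult (x y : 'I_k + inner G) : nat :=
  if dir then orientation x y else orientation x y || orientation y x.

Lemma gadget_mult_loop x : gadget_mult x x = 0%N.
Proof.
rewrite /gadget_mult orbb if_same.
by case: (boolP (orientation x x)) => // h; have := orientation_asym h; rewrite h.
Qed.

Lemma gadget_mult_sym : ~~ dir -> forall x y, gadget_mult x y = gadget_mult y x.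
Proof. by rewrite /gadget_mult => /negbTE -> x y; rewrite orbC. Qed.

Definition lgraph_of : lgraph dir k :=
  LGraph gadget_mult_loop gadget_mult_sym (@inl_inj 'I_k (inner G)).

Lemma lgraph_of_simp : PLG_simp lgraph_of.
Proof.
rewrite /PLG_simp /nedges_between /= /gadget_mult.
split=> [x y|i j]; case: dir => //=.
- case: (boolP (orientation x y)) => [/orientation_asym/negbTE -> //|_].
  by case: orientation.
- by case: (_ || _).
Qed.

Lemma hom_lab_lgraph_of H (phi : 'I_k -> vertex H) :
  hom_lab lgraph_of phi = gval G phi.
Proof.
(* The labeled nodes are forced to follow phi, so of the sum over their images only one term
   survives. *)
rewrite /hom_lab big_mkcond sum_ffun_join (bigD1 (finfun phi)) //=.
rewrite [X in _ + X]big1 ?addr0; last first.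
  move=> a ne; apply: big1 => b _; case: ifP => // /forallP h.
  by case/eqP: ne; apply/ffunP => i; have := eqP (h i); rewrite !ffunE.
apply: eq_bigr => f _; rewrite ifT; last first.
  by apply/forallP => i; rewrite !ffunE /= ffunE.
set fj := finfun _.
rewrite [X in _ * X](_ : _ = \prod_u \prod_v
    eweight (fj u) (fj v) ^+ orientation u v); last first.
  apply: (@prod_oriented_edges _ _ dir orientation
    (fun u v => eweight (fj u) (fj v)) (fun x => enum_rank x)).
  - exact: orientation_asym.
  - by move=> x y /val_inj /enum_rank_inj.
  - by move=> ndir u v; apply: eweight_sym.
rewrite {}/fj.
rewrite big_mkcond !big_sumType /= [X in X * _ * _]big1 ?mul1r; last first.
  by move=> i _; rewrite codom_f.
under eq_bigr => w _.
  rewrite ifT; last by apply/negP => /codomP [].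
  rewrite !ffunE /=; over.
under [X in _ * (X * _)]eq_bigr => i _.
  rewrite big_sumType /= big1 ?mul1r; last by [].
  over.
under [X in _ * (_ * X)]eq_bigr do rewrite big_sumType /=.
rewrite exchange_big -!big_split; apply: eq_bigr => w _ /=.
rewrite -mulrA; congr (_ * _).
rewrite mulrA -big_split /=; congr (_ * _); apply: eq_bigr => i _.
  rewrite !ffunE /= ffunE /link.
  by case: att => [[]|] /=; rewrite ?expr0 ?expr1 ?mulr1 ?mul1r.
by rewrite !ffunE.
Qed.

End Realization.

(** * Gluing along labels *)

Section Gluing.

Variable A : finType.

Definition gadget1 : gadget A :=
  @Gadget A void (fun w => of_void _ w) (fun _ _ => false) (fun _ _ _ => isT).

Lemma gval_gadget1 H (eta : A -> vertex H) : gval gadget1 eta = 1.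
Proof.
rewrite /gval; under eq_bigr => f _ do rewrite big1 => [|[]//].
by rewrite sumr_const card_ffun card_void expn0.
Qed.

Definition glue_adj (G G' : gadget A) : rel (inner G + inner G') := fun x y =>
  match x, y with
  | inl u, inl v => adj u v
  | inr u, inr v => adj u v
  | _, _ => false
  end.

Lemma glue_adj_asym G G' x y : @glue_adj G G' x y -> ~~ @glue_adj G G' y x.
Proof. by case: x y => [x|x] [y|y] //=; apply: adj_asym. Qed.

(** Gluing keeps the graph simple: inner nodes stay disjoint and labels are never adjacent, so no
    parallel edges arise. *)
Definition glue (G G' : gadget A) : gadget A :=
  @Gadget A _ (join (@att _ G) (@att _ G')) _ (@glue_adj_asym G G').

Lemma gval_glue G G' H (eta : A -> vertex H) :
  gval (glue G G') eta = gval G eta * gval G' eta.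
Proof.
rewrite /gval sum_ffun_join mulr_suml; apply: eq_bigr => f _.
rewrite mulr_sumr; apply: eq_bigr => f' _.
rewrite big_sumType /=; congr (_ * _); apply: eq_bigr => w _.
  rewrite !ffunE /= big_sumType /= [X in _ * (_ * X)]big1 // mulr1.
  by congr (_ * _); apply: eq_bigr => w' _; rewrite ffunE.
rewrite !ffunE /= big_sumType /= [X in _ * (X * _)]big1 // mul1r.
by congr (_ * _); apply: eq_bigr => w' _; rewrite ffunE.
Qed.

Definition glue_all (I : Type) (G : I -> gadget A) (s : seq I) : gadget A :=
  foldr (fun i => glue (G i)) gadget1 s.

Lemma gval_glue_all I (G : I -> gadget A) s H (eta : A -> vertex H) :
  gval (glue_all G s) eta = \prod_(i <- s) gval (G i) eta.
Proof.
elim: s => [|i s IH]; first by rewrite big_nil gval_gadget1.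
by rewrite big_cons gval_glue IH.
Qed.

End Gluing.

(** * Turning the labels in J into inner nodes *)

Section Unlabeling.

Variables A J : finType.

Definition unlabel_att (G : gadget (A + J)) (x : J + inner G) (a : A) :=
  if x is inr w then att w (inl a) else None.

Definition unlabel_adj (G : gadget (A + J)) : rel (J + inner G) := fun x y =>
  match x, y with
  | inl _, inl _ => false
  | inr w, inl j => att w (inr j) == Some true
  | inl j, inr w => att w (inr j) == Some false
  | inr w, inr w' => adj w w'
  end.

Lemma unlabel_adj_asym G x y : @unlabel_adj G x y -> ~~ @unlabel_adj G y x.
Proof.
by case: x y => [i|w] [j|w'] //=; [move/eqP-> | move/eqP-> | move/adj_asym].
Qed.

Definition unlabel (G : gadget (A + J)) : gadget A :=
  Gadget (@unlabel_att G) (@unlabel_adj_asym G).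

Lemma gval_unlabel G H (phi : A -> vertex H) :
  gval (unlabel G) phi =
  \sum_(eta : {ffun J -> vertex H})
     (\prod_j vweight (eta j)) * gval G (join phi eta).
Proof.
rewrite /gval sum_ffun_join; apply: eq_bigr => eta _.
rewrite mulr_sumr; apply: eq_bigr => f _.
rewrite big_sumType /=.
under eq_bigr => j _.
  rewrite !ffunE /= big1 // mulr1 big_sumType /= big1 ?mul1r; last by [].
  over.
rewrite big_split /= -mulrA; congr (_ * _).
rewrite exchange_big -big_split; apply: eq_bigr => w _ /=.
rewrite !ffunE /= !big_sumType /=.
under [X in _ * (_ * (_ * X)) = _]eq_bigr do rewrite ffunE /=.
set al := vweight _; set P := \prod_i link _ _ _; set S := \prod_i _ ^+ adj _ _.
(* The edges to the former labels are split by orientation, matching the two mixed cases of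
   [unlabel_adj]. *)
have -> : \prod_j link (att w (inr j)) (f w) (eta j) =
  \prod_j eweight (eta j) (f w)
     ^+ (att w (inr j) == Some false) *
  \prod_j eweight (f w) (finfun (join eta f) (inl j))
     ^+ (att w (inr j) == Some true).
  rewrite -big_split; apply: eq_bigr => j _ /=; rewrite !ffunE /= /link.
  by case: att => [[]|] /=; rewrite ?expr0 ?expr1 ?mulr1 ?mul1r.
by ring.
Qed.

End Unlabeling.

(** * Test gadgets with one or two inner nodes *)

Section Tests.

Variable A : finType.

Definition single (a : {ffun A -> option bool}) : gadget A :=
  @Gadget A unit (fun=> a) (fun _ _ => false) (fun _ _ _ => isT).

Definition double_adj : rel (unit + unit) := fun x y =>
  if x is inl _ then if y is inr _ then true else false else false.

Lemma double_adj_asym x y : double_adj x y -> ~~ double_adj y x.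
Proof. by case: x y => [x|x] [y|y]. Qed.

Definition double (p : {ffun A -> option bool} * {ffun A -> option bool}) :
    gadget A :=
  Gadget (join (fun=> p.1 : A -> _) (fun=> p.2 : A -> _)) double_adj_asym.

(** As a function of v this is a monomial in the edge weights between v and the labels. *)
Definition attached H (a : A -> option bool) (eta : A -> vertex H) (v : vertex H) :=
  \prod_l link (a l) v (eta l).

Lemma gval_single a H (eta : A -> vertex H) :
  gval (single a) eta = \sum_v vweight v * attached a eta v.
Proof.
rewrite /gval sum_ffun_unit; apply: eq_bigr => v _.
by rewrite (big_pred1 tt) => [|[]//]; rewrite (big_pred1 tt) => [|[]//]; rewrite ffunE mulr1.
Qed.

Lemma gval_double p H (eta : A -> vertex H) :
  gval (double p) eta = \sum_v (vweight v * \sum_w (vweight w * eweight v w *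
    attached p.2 eta w)) * attached p.1 eta v.
Proof.
rewrite /gval sum_ffun_join sum_ffun_unit; apply: eq_bigr => v _.
rewrite sum_ffun_unit mulr_sumr mulr_suml; apply: eq_bigr => w _.
rewrite big_sumType /= !(big_pred1 tt) => [|[]//|[]//].
rewrite !big_sumType /= !(big_pred1 tt); try by case.
rewrite !ffunE /= !ffunE -/(attached _ _ _) -/(attached _ _ _).
by rewrite expr1 !expr0; ring.
Qed.

Definition test : finType :=
  ({ffun A -> option bool} +
   {ffun A -> option bool} * {ffun A -> option bool})%type.

Definition test_gadget (t : test) : gadget A :=
  match t with inl a => single a | inr p => double p end.

(** A simple graph has at most one edge from a node to each label, hence the distinctness of the
    labels in s; powers must come from several labels at the same vertex. *)
Lemma attach_seq (s : seq (A * option bool)) : uniq (unzip1 s) ->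
  exists a : {ffun A -> option bool}, forall H (eta : A -> vertex H) v,
    attached a eta v = \prod_(x <- s) link x.2 v (eta x.1).
Proof.
(* The induction also needs [a] to be [None] off s, so that the next label is still free. *)
move=> us; suff [a [_ h]] : exists a : {ffun A -> option bool},
    (forall l, l \notin unzip1 s -> a l = None) /\
    forall H (eta : A -> vertex H) v,
      attached a eta v = \prod_(x <- s) link x.2 v (eta x.1) by exists a.
elim: s us => [_|[l o] s IH /= /andP [nl /IH [a [a0 ha]]]].
  exists [ffun=> None]; split=> [l _|H eta v]; first by rewrite ffunE.
  by rewrite big_nil /attached big1 // => l _; rewrite ffunE.
exists [ffun l' => if l' == l then o else a l']; split=> [l'|H eta v].
  by rewrite inE negb_or ffunE => /andP [/negbTE -> /a0].
rewrite big_cons -ha /attached (bigD1 l) //= ffunE eqxx; congr (_ * _).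
rewrite [RHS](bigD1 l) //= a0 //= mul1r.
by apply: eq_bigr => l' /negbTE ne; rewrite ffunE ne.
Qed.

End Tests.

End Gadgets.

(** * Rigidity of labeled twin-free graphs *)

Lemma pigeonhole (T Y : finType) (f : T -> Y) (M : nat) :
  (M * #|Y| < #|T|)%N -> exists y, (M < #|[set t | f t == y]|)%N.
Proof.
move=> lt_MY_T; apply/existsP; rewrite -[[exists _, _]]negbK negb_exists.
apply: contraL lt_MY_T => /forallP small; rewrite -leqNgt.
rewrite -sum1_card (partition_big f xpredT) //= mulnC -sum_nat_const.
apply: leq_sum => y _; rewrite sum1dep_card leqNgt.
exact: small.
Qed.

Section Rigidity.

Variables (F : fieldType) (dir : bool).

(** Each factor in [ks] gets its own index in T0, so repeated factors use distinct labels. The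
    strict bound leaves one index to spare in case l itself occupies one. *)
Lemma attach_probe (B V T : finType) (T0 : {set T}) (l : B + V * T)
    (o : option bool) (ks : seq (V * bool)) : (size ks < #|T0|)%N ->
  exists a : {ffun B + V * T -> option bool},
  forall (H : wgraph F dir) (nu : B + V * T -> vertex H) (sg : V -> vertex H),
    (forall u t, t \in T0 -> nu (inr (u, t)) = sg u) ->
  forall v, attached a nu v =
    link o v (nu l) * \prod_(kap <- ks) link (Some kap.2) v (sg kap.1).
Proof.
move=> lt_ks_T0.
pose copy (x : B + V * T) := if x is inr p then Some p.2 else None.
pose T1 := [set t in T0 | Some t != copy l].
have le_ks_T1 : (size ks <= #|T1|)%N.
  rewrite /T1; case: l @copy T1 => [b|[u t]] copy T1 /=.
    rewrite ltnW //; apply: leq_trans lt_ks_T0 _; apply: subset_leq_card.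
    by apply/subsetP => t; rewrite inE => ->.
  rewrite -ltnS; apply: leq_trans lt_ks_T0 _.
  rewrite (cardsD1 t) -add1n leq_add ?leq_b1 //; apply: subset_leq_card.
  apply/subsetP => t'; rewrite !inE => /andP [ne ->].
  by apply: contra ne => /eqP [->].
pose ts := take (size ks) (enum T1).
have size_ts : size ts = size ks by rewrite size_takel // -cardE.
have ts_T1 t : t \in ts -> t \in T1 by move/mem_take; rewrite mem_enum.
pose s := (l, o) ::
  [seq (inr (p.1.1, p.2) : B + V * T, Some p.1.2) | p <- zip ks ts].
have copies : map copy (unzip1 s) = copy l :: map Some ts.
  rewrite /= -[in RHS](@unzip2_zip _ _ ks ts) ?size_ts // /unzip1 /unzip2 -!map_comp.
  by congr cons; apply: eq_map.
have [|a a_s] := @attach_seq F dir _ s.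
  apply: (@map_uniq _ _ copy); rewrite copies /=; apply/andP; split.
    apply/mapP => -[t /ts_T1]; rewrite inE => /andP [_ ne] eq_l.
    by rewrite eq_l eqxx in ne.
  by rewrite map_inj_uniq ?take_uniq ?enum_uniq // => x y [].
exists a => H nu sg nuE v; rewrite a_s big_cons big_map /=; congr (_ * _).
rewrite -[in RHS](@unzip1_zip _ _ ks ts) ?size_ts // big_map.
apply: eq_big_seq => -[kap t] /(map_f snd); rewrite [map _ _]unzip2_zip ?size_ts //=.
by move/ts_T1; rewrite inE => /andP [tT0 _]; rewrite nuE.
Qed.

Lemma twin_free_eq (H : wgraph F dir) (u v : vertex H) : twin_free H ->
  (forall l, eweight u l = eweight v l) -> (forall l, eweight l u = eweight l v) ->
  u = v.
Proof.
move=> tf e1 e2; apply/eqP; apply: contraT => /eqP ne.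
by case: (tf u v ne) => l; split.
Qed.

Lemma twin_free_iso (H H' : wgraph F dir) (tau : vertex H -> vertex H') :
  twin_free H -> wgraph_iso tau -> twin_free H'.
Proof.
move=> tf [[rho tauK rhoK] _ be] i j ne tw; apply: ne.
rewrite -(rhoK i) -(rhoK j); congr (tau _).
by apply: twin_free_eq => // l; rewrite -!be !rhoK; case: (tw (tau l)).
Qed.

(* If every vertex of a twin-free graph [H] carries many labels, each vertex is
   singled out by a polynomial in its edge weights to the labels; by pigeonhole
   enough of these labels are also constant under [mu]. *)
Lemma labeled_rigidity (H H' : wgraph F dir) (B : finType) (N : nat)
    (eta : B + vertex H * 'I_N -> vertex H)
    (mu : B + vertex H * 'I_N -> vertex H') :
  twin_free H -> (#|vertex H'| <= #|vertex H|)%N ->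
  ((#|vertex H| + #|vertex H'|) * #|{ffun vertex H -> vertex H'}| < N)%N ->
  (forall u t, eta (inr (u, t)) = u) ->
  (forall t : test (B + vertex H * 'I_N)%type,
     gval (test_gadget t) eta = gval (test_gadget t) mu) ->
  exists tau : vertex H -> vertex H', wgraph_iso tau /\ mu =1 tau \o eta.
Proof.
move=> tf le_card ltN etaE tests.
pose copies t := [ffun u => mu (inr (u, t))].
(* More than |V(H)| + |V(H')| indices t induce the same map [sg]: enough copies for every product
   that separation on the union of both vertex sets requires. *)
have [|sg] := @pigeonhole 'I_N _ copies (#|vertex H| + #|vertex H'|).
  by rewrite card_ord.
set T0 := [set t | _] => ltT0.
have muE u t : t \in T0 -> mu (inr (u, t)) = sg u.
  by rewrite inE => /eqP <-; rewrite ffunE.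
have [t0 _] : exists t0, t0 \in T0.
  by apply/set0Pn; rewrite -card_gt0 (leq_ltn_trans _ ltT0).
pose ga (kap : vertex H * bool) v := link (Some kap.2) v kap.1.
pose ga' (kap : vertex H * bool) v := link (Some kap.2) v (sg kap.1).
have probe l o ks : (size ks <= #|vertex H| + #|vertex H'|)%N ->
    exists a : {ffun _ -> _},
      (forall v, attached a eta v =
         link o v (eta l) * \prod_(kap <- ks) ga kap v) /\
      (forall v, attached a mu v =
         link o v (mu l) * \prod_(kap <- ks) ga' kap v).
  rewrite -ltnS => /leq_trans /(_ ltT0) /(attach_probe l o) [a ha].
  by exists a; split=> v; [apply: (ha _ _ id) | apply: (ha _ _ sg)].
have ga_inj v w : (forall kap, ga kap v = ga kap w) -> v = w.
  move=> e; apply: (twin_free_eq tf) => l.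
    exact: (e (l, true)).
  exact: (e (l, false)).
pose C v v' := [forall kap, ga' kap v' == ga kap v].
(* Separation is applied to the disjoint union of the vertex sets with weights Q and -Q'. By
   twin-freeness, v is the only vertex of H in its class; the members from H' are those with
   [C v v']. *)
have interp (Q : vertex H -> F) (Q' : vertex H' -> F) :
    (forall ks : seq (vertex H * bool),
       (size ks <= #|vertex H| + #|vertex H'|)%N ->
       \sum_v Q v * \prod_(kap <- ks) ga kap v =
       \sum_v Q' v * \prod_(kap <- ks) ga' kap v) ->
    forall v, Q v = \sum_(v' | C v v') Q' v'.
  move=> eqQ v.
  have : \sum_(x | [forall kap, join (ga kap) (ga' kap) x == ga kap v])
      join Q (fun v => - Q' v) x = 0.
    apply: (separation _ (inl v)) => ks.
    rewrite card_sum => /eqQ e; rewrite big_sumType /= e -big_split big1 // => w _.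
    by rewrite /= mulNr subrr.
  rewrite big_sumType /= sumrN (big_pred1 v) => [/eqP|w].
    by rewrite subr_eq0 => /eqP.
  apply/forallP/eqP => [e|-> kap]; last exact: eqxx.
  by apply: ga_inj => kap; apply/eqP.
have link_eq l o v : vweight v * link o v (eta l) =
    \sum_(v' | C v v') vweight v' * link o v' (mu l).
  apply: (interp (fun v => vweight v * link o v (eta l))) => ks /(probe l o) [a [ae am]].
  have := tests (inl a); rewrite /= !gval_single => e.
  transitivity (\sum_v vweight v * attached a eta v).
    by apply: eq_bigr => v' _; rewrite ae mulrA.
  by rewrite e; apply: eq_bigr => v' _; rewrite am mulrA.
(* With [None], [link_eq] equates the nonzero weight of v with a sum over [C v], so this class is
   inhabited. *)
have /fin_all_exists [tau tauC] v : exists v', C v v'.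
  apply/existsP; apply: contraT; rewrite negb_exists => /forallP none.
  have := link_eq (inr (v, t0)) None v.
  rewrite big1 => [/eqP|v' Cv']; last by have := none v'; rewrite Cv'.
  by rewrite mulr1 (negbTE (vweight_neq0 v)).
have tauE kap v : ga' kap (tau v) = ga kap v by apply/eqP/(forallP (tauC v)).
have tau_inj : injective tau.
  by move=> v w e; apply: ga_inj => kap; rewrite -!tauE e.
have tau_bij : bijective tau := inj_card_bij tau_inj le_card.
have [rho tauK rhoK] := tau_bij.
(* Since tau is onto and distinct vertices of H have distinct characters, each class is a singleton
   and the sums above collapse. *)
have Cpred1 v : C v =1 pred1 (tau v).
  move=> v' /=; apply/idP/eqP => [Cv'|-> //].
  rewrite -(rhoK v'); congr (tau _); apply: ga_inj => kap.
  by rewrite -tauE rhoK; apply/eqP/(forallP Cv').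
have link_tau l o v : vweight v * link o v (eta l) =
    vweight (tau v) * link o (tau v) (mu l).
  by rewrite link_eq (big_pred1 _ (Cpred1 v)).
have al_tau v : vweight (tau v) = vweight v.
  by have := link_tau (inr (v, t0)) None v; rewrite !mulr1.
have {}link_tau l o v : link o (tau v) (mu l) = link o v (eta l).
  by apply: (mulfI (vweight_neq0 v)); rewrite link_tau al_tau.
(* Double gadgets are interpolated twice: first at the outer node ([e1]), then at the inner one. The
   label l is a placeholder, [None] giving it the factor 1. *)
have be_tau v w : eweight (tau v) (tau w) = eweight v w.
  pose l : B + vertex H * 'I_N := inr (v, t0).
  have e1 ks : (size ks <= #|vertex H| + #|vertex H'|)%N ->
      vweight v * \sum_w (vweight w * eweight v w * \prod_(kap <- ks) ga kap w) =
      vweight (tau v) * \sum_w (vweight w * eweight (tau v) w *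
        \prod_(kap <- ks) ga' kap w).
    move=> /(probe l None) [a2 [ae2 am2]].
    pose Q x := vweight x * \sum_w (vweight w * eweight x w *
      \prod_(kap <- ks) ga kap w).
    pose Q' x := vweight x * \sum_w (vweight w * eweight x w *
      \prod_(kap <- ks) ga' kap w).
    rewrite -/(Q v) -/(Q' (tau v)) (interp Q Q') ?(big_pred1 _ (Cpred1 v)) //.
    move=> ks1 /(probe l None) [a1 [ae1 am1]].
    have := tests (inr (a1, a2)); rewrite /= !gval_double /= => e.
    transitivity (\sum_x vweight x *
        (\sum_w vweight w * eweight x w * attached a2 eta w) * attached a1 eta x).
      apply: eq_bigr => x _; rewrite ae1 mul1r; congr (_ * _ * _).
      by apply: eq_bigr => y _; rewrite ae2 mul1r.
    rewrite e; apply: eq_bigr => x _; rewrite am1 mul1r; congr (_ * _ * _).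
    by apply: eq_bigr => y _; rewrite am2 mul1r.
  have : vweight w * eweight v w =
      \sum_(w' | C w w') vweight w' * eweight (tau v) w'.
    apply: (interp (fun w => vweight w * eweight v w)) => ks /e1.
    by rewrite al_tau => /(mulfI (vweight_neq0 v)).
  by rewrite (big_pred1 _ (Cpred1 w)) al_tau => /(mulfI (vweight_neq0 w)).
have iso : wgraph_iso tau by split.
(* By [link_tau], [mu l] and [tau (eta l)] have the same edge weights to and from all of H', which
   is twin-free. *)
exists tau; split=> // l /=; apply: twin_free_eq (twin_free_iso tf iso) _ _ => x.
  by rewrite -(rhoK x) be_tau; apply: (link_tau l (Some false)).
by rewrite -(rhoK x) be_tau; apply: (link_tau l (Some true)).
Qed.

End Rigidity.

(** * Comparing extensions of phi and psi *)

Lemma hom_lab_eq_iso (F : fieldType) (dir : bool) (H H' : wgraph F dir)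
    (k : nat) (phi : 'I_k -> vertex H) (psi : 'I_k -> vertex H') :
  [pchar F] =i pred0 -> twin_free H -> (#|vertex H'| <= #|vertex H|)%N ->
  (forall G : lgraph dir k, PLG_simp G -> hom_lab G phi = hom_lab G psi) ->
  exists sigma : vertex H -> vertex H', wgraph_iso sigma /\ psi =1 sigma \o phi.
Proof.
move=> charF0 tfH le_m'm hom_eq.
(* Rigidity is used for H against itself and for H against H'; N exceeds both pigeonhole
   thresholds. *)
pose bound (H1 : wgraph F dir) :=
  ((#|vertex H| + #|vertex H1|) * #|{ffun vertex H -> vertex H1}|)%N.
pose N := (bound H + bound H').+1.
pose J : finType := (vertex H * 'I_N)%type.
pose eta0 : {ffun J -> vertex H} := [ffun p => p.1].
have rigid (H1 : wgraph F dir) (mu : 'I_k + J -> vertex H1) :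
    (#|vertex H1| <= #|vertex H|)%N -> (bound H1 < N)%N ->
    (forall t : test ('I_k + J)%type,
       gval (test_gadget t) mu = gval (test_gadget t) (join phi eta0)) ->
    exists tau : vertex H -> vertex H1,
      wgraph_iso tau /\ mu =1 tau \o join phi eta0.
  move=> le lt e; apply: labeled_rigidity => // u t.
  by rewrite /= ffunE.
pose val (H1 : wgraph F dir) (chi : 'I_k -> vertex H1) (t : test ('I_k + J)%type)
  (eta : {ffun J -> vertex H1}) := gval (test_gadget t) (join chi eta).
have sums (ks : seq (test ('I_k + J)%type)) :
    \sum_(eta : {ffun J -> vertex H}) (\prod_j vweight (eta j)) *
       \prod_(t <- ks) val H phi t eta =
    \sum_(eta : {ffun J -> vertex H'}) (\prod_j vweight (eta j)) *
       \prod_(t <- ks) val H' psi t eta.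
  pose G := unlabel (glue_all (@test_gadget _) ks).
  have := hom_eq _ (lgraph_of_simp dir G).
  rewrite !hom_lab_lgraph_of !gval_unlabel => e.
  transitivity (\sum_(eta : {ffun J -> vertex H}) (\prod_j vweight (eta j)) *
      gval (glue_all (@test_gadget _) ks) (join phi eta)).
    by apply: eq_bigr => eta _; rewrite gval_glue_all.
  by rewrite e; apply: eq_bigr => eta _; rewrite gval_glue_all.
have : \sum_(x | [forall t, join (val H phi t) (val H' psi t) x ==
                           val H phi t eta0])
    join (fun eta : {ffun J -> _} => \prod_j vweight (eta j))
         (fun mu : {ffun J -> _} => - \prod_j vweight (mu j)) x = 0.
  apply: (separation _ (inl eta0)) => ks _.
  rewrite big_sumType /= sums -big_split big1 // => mu _.
  by rewrite /= mulNr subrr.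
rewrite big_sumType /= sumrN => /eqP; rewrite subr_eq0 => /eqP.
(* Rigidity of H against itself: every eta in the class of [eta0] is [eta0] followed by an
   automorphism, so it has the same product of weights. *)
rewrite (eq_bigr (fun=> \prod_j vweight (eta0 j))); last first.
  move=> eta /forallP e.
  have [|||tau [[_ al _] tauE]] := rigid H (join phi eta) => //.
  - by rewrite ltnS leq_addr.
  - by move=> t; apply/eqP/e.
  by apply: eq_bigr => j _; have /= -> := tauE (inr j); rewrite al.
rewrite sumr_const => count.
(* Otherwise the right side of [count] is an empty sum, while the left is a nonzero product times
   the size of a class containing [eta0], nonzero in characteristic 0. *)
have /existsP [mu /forallP mu_eq] : [exists mu : {ffun J -> vertex H'},
    [forall t, val H' psi t mu == val H phi t eta0]].
  apply: contraT; rewrite negb_exists => /forallP none; move: count.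
  rewrite [RHS]big1 => [/eqP|mu h]; last by have := none mu; rewrite h.
  rewrite -mulr_natr mulf_eq0 => /orP [/prodf_eq0 [j _]|].
    by rewrite (negbTE (vweight_neq0 _)).
  rewrite ((pcharf0P F).1 charF0) => /eqP card0.
  suff : (0 < 0)%N by [].
  rewrite -[X in (_ < X)%N]card0; apply/card_gt0P; exists eta0.
  by rewrite unfold_in; apply/forallP => t.
have [|||tau [iso tauE]] := rigid H' (join psi mu) => //.
- by rewrite ltnS leq_addl.
- by move=> t; apply/eqP/mu_eq.
by exists tau; split=> // i; apply: (tauE (inl i)).
Qed.

Local Close Scope ring_scope.

Theorem theorem3p1 (F : fieldType) (charF0 : [pchar F]%R =i pred0)
    (dir : bool) (H H' : wgraph F dir) (tfH : twin_free H)
    (le_m'm : #|vertex H'| <= #|vertex H|)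
    (k : nat) (phi : 'I_k -> vertex H) (psi : 'I_k -> vertex H')
    (hom_eq : forall G : lgraph dir k, PLG_simp G -> hom_lab G phi = hom_lab G psi) :
  (exists sigma : vertex H -> vertex H',
      wgraph_iso sigma /\ psi =1 sigma \o phi)
  /\ twin_free H' /\ #|vertex H| = #|vertex H'|.
Proof.
have [sigma [iso e]] := hom_lab_eq_iso charF0 tfH le_m'm hom_eq.
split; first by exists sigma.
split; first exact: twin_free_iso iso.
by case: iso => /bij_eq_card.
Qed.
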